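(* There exists a smooth map $F$ of a solid torus $S^1\times M$ (where $M$ is a closed two-dimensional disk) to itself which is a skew product over the octupling map $\varphi\mapsto 8\varphi$ of the circle $S^1$, i.e. $F(\varphi,x)=(8\varphi,f_\varphi(x))$ with fiber maps $f_\varphi:M\to M$, and which has a Milnor topological attractor $A$ whose interior is not forward invariant under $F$, i.e. $F(\operatorname{interior}(A))\not\subset\operatorname{interior}(A)$.
   Context: Here $S^1=\mathbb{R}/2\pi\mathbb{Z}$, and the interior is taken in the phase space $S^1\times M$. For a continuous map $F:X\to X$ of a compact metric space and a compact set $A\subset X$ with $F(A)=A$, put $\beta_F(A)=\{x\in X:\omega_F(x)\subset A\}$, where $\omega_F(x)$ is the $\omega$-limit set of $x$. A compact set $A$ with $F(A)=A$ is a (Milnor) topological attractor if $\beta_F(A)$ is not meager and, for every compact set $A'\subsetneq A$ with $F(A')=A'$, the set $\beta_F(A)\setminus\beta_F(A')$ is not meager. *)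

(* Defs.v *)
From HB Require Import structures.
From mathcomp Require Import all_boot all_order all_algebra.
From mathcomp Require Import all_classical all_reals all_analysis.

Set Implicit Arguments.
Unset Strict Implicit.
Unset Printing Implicit Defensive.

Import Order.TTheory GRing.Theory Num.Theory.
Import numFieldNormedType.Exports.

Local Open Scope classical_set_scope.
Local Open Scope ring_scope.
Local Open Scope quotient_scope.

Section Dynamics.
Context {T : topologicalType}.
Implicit Types (A : set T) (F : T -> T).

Definition nowhere_dense A := (closure A)° = set0.

Definition meager A :=
  exists2 B : nat -> set T,
    (forall n, nowhere_dense (B n)) & A `<=` \bigcup_n B n.

Definition omega_limit F (x : T) : set T := cluster (iter n F x @[n --> \oo]).

Lemma omega_limitE F x :
  omega_limit F x = \bigcap_N closure [set iter n F x | n in [set n | (N <= n)%N]].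
Proof.
rewrite /omega_limit clusterE; apply/seteqP; split => y yP.
- move=> N _; apply: yP; exists N => // n /= Nn; by exists n.
- move=> B [N _ NB]; apply: closureS (yP N I) => _ [n Nn <-]; exact: NB.
Qed.

Definition basin F A := [set x | omega_limit F x `<=` A].

Definition Milnor_topological_attractor F A :=
  [/\ compact A,
      F @` A = A,
      ~ meager (basin F A) &
      forall A', compact A' -> F @` A' = A' -> A' `<` A ->
        ~ meager (basin F A `\` basin F A')].

End Dynamics.

Section Smooth.
Context {R : realType} {V W : normedModType R}.

(* On finite-dimensional spaces this is the usual class C^n on an open set U:
   continuity of all the directional derivatives up to order n is continuity
   of the successive Frechet differentials. *)
Fixpoint Cn_on (n : nat) (U : set V) (g : V -> W) : Prop :=
  if n is n'.+1 then
    (forall x, U x -> differentiable g x) /\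
    (forall v, Cn_on n' U (fun x => 'D_v g x))
  else forall x, U x -> {for x, continuous g}.

Definition smooth_on (U : set V) (g : V -> W) := forall n, Cn_on n U g.

End Smooth.

Section SolidTorus.
Variable R : realType.

Definition twopiZ : {pred R} := [pred x | `[< exists k : int, x = 2 * pi *~ k >]].

Fact twopiZ_zmod_closed : zmod_closed twopiZ.
Proof.
split=> [|x y]; first by apply/asboolP; exists 0; rewrite mulr0z.
move=> /asboolP[k xk] /asboolP[l yl]; apply/asboolP; exists (k - l).
by rewrite xk yl mulrzBr.
Qed.

HB.instance Definition _ := GRing.isZmodClosed.Build R twopiZ twopiZ_zmod_closed.

Definition circle : Type := quotient_topology (Quotient.quot twopiZ).

HB.instance Definition _ := Topological.on circle.
HB.instance Definition _ := Quotient.on circle.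
HB.instance Definition _ := GRing.isZmodule.Build circle
  (@addrA (Quotient.quot twopiZ)) (@addrC (Quotient.quot twopiZ))
  (@add0r (Quotient.quot twopiZ)) (@addNr (Quotient.quot twopiZ)).

Definition octupling (phi : circle) : circle := phi *+ 8.

Definition disk : set (R^o * R^o) := [set x | x.1 ^+ 2 + x.2 ^+ 2 <= 1].

Definition solid_torus : Type := (circle * disk)%type.

HB.instance Definition _ := Topological.on solid_torus.

Local Notation cover := (R^o * (R^o * R^o))%type.

(* [lies_over p q]: q is the image of p under the projection of the cover
   R x disk onto the solid torus R/2piZ x disk. *)
Definition lies_over (p : cover) (q : solid_torus) :=
  \pi_circle p.1 = q.1 /\ p.2 = \val q.2.

(* The projection of the cover is a local diffeomorphism, so its local sections
   are the charts.  As usual on a manifold with boundary, a map read in charts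
   is smooth when near each point it extends to a C^oo map on an open subset of
   the ambient vector space. *)
Definition smooth_torus_map (F : solid_torus -> solid_torus) :=
  forall p0 : cover, disk p0.2 ->
    exists U : set cover, exists g : cover -> cover,
      [/\ open_nbhs p0 U, smooth_on U g &
          forall p q, U p -> lies_over p q -> lies_over (g p) (F q)].

Definition octupling_skew_product (F : solid_torus -> solid_torus) :=
  exists f : circle -> disk -> disk,
    forall phi x, F (phi, x) = (octupling phi, f phi x).

Lemma pi_circle_eq (s t : R) :
  \pi_circle s = \pi_circle t <-> exists k : int, s - t = 2 * pi *~ k.
Proof.
change (s = t %[mod Quotient.quot twopiZ] <->
        exists k : int, s - t = 2 * pi *~ k).
split=> [/eqP | stk]; first by rewrite -Quotient.idealrBE => /asboolP.
by apply/eqP; rewrite -Quotient.idealrBE; apply/asboolP.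
Qed.

Lemma octupling_pi (t : R) : octupling (\pi_circle t) = \pi_circle (8 * t).
Proof.
have piMn n : (\pi_circle t) *+ n = \pi_circle (t *+ n).
  elim: n => [|n IHn]; first exact/esym/(@pi_zeror _ _ _ _ _ (Quotient.quot twopiZ)).
  rewrite !mulrS IHn.
  exact/esym/(@pi_addr _ _ _ _ _ (Quotient.quot twopiZ)).
by rewrite /octupling piMn mulr_natl.
Qed.

End SolidTorus.

(* Main.v *)
Require Import Defs.
From mathcomp Require Import all_boot all_order all_algebra.
From mathcomp Require Import all_classical all_reals all_analysis.
From mathcomp Require Import ring lra.

(* Over the angle phi put the affine contraction
     z |-> w(phi) z + (1 - w(phi)) e(phi) / 2,   e(phi) = (cos phi, sin phi),
   with ratio w(phi) = 9/10 (1 - cos(2 phi)^6), and let A be the intersection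
   of the forward images of the solid torus.  Every fiber map is a contraction
   and every arc is eventually expanded over the whole circle, so a generic
   orbit accumulates at each point of A, which makes A a Milnor topological
   attractor (the solid torus, being compact Hausdorff, is not meager).

   For every t and every quadrant, one of the eight preimages psi of t
   satisfies cos(2 psi)^2 <= 1/2 with e(psi) in that quadrant; the
   corresponding fiber map is then so close to the identity that the four
   images of the square Q = [-1/6, 1/6]^2 cover Q.  Hence S^1 x Q is contained
   in A.  On the other hand w(0) = 0, so F(0, 0) = (0, (1/2, 0)), whereas A
   lies in the half-space x <= 1/2: the interior point (0, 0) of A is sent to
   the boundary of A. *)

Set Implicit Arguments.
Unset Strict Implicit.
Unset Printing Implicit Defensive.

Import Order.TTheory GRing.Theory Num.Theory.
Import numFieldNormedType.Exports.

Local Open Scope classical_set_scope.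

(** * Compact Hausdorff spaces: Baire category and global attractors *)

Lemma hausdorff_inj (S T : topologicalType) (h : S -> T) :
  continuous h -> injective h -> hausdorff_space T -> hausdorff_space S.
Proof.
move=> ch ih hT x y xy; apply/ih/hT => A B /ch hA /ch hB.
by have [z [Az Bz]] := xy _ _ hA hB; exists (h z).
Qed.

Section CompactDynamics.
Context {T : topologicalType}.
Hypothesis T_compact : compact [set: T].
Hypothesis T_hausdorff : hausdorff_space T.

Lemma closed_is_compact (C : set T) : closed C -> compact C.
Proof. by move=> cC; apply: (subclosed_compact cC T_compact). Qed.

Lemma closed_nbhs_shrink (x : T) (U : set T) :
  nbhs x U -> exists W, [/\ open W, W x & closure W `<=` U].
Proof.
move=> /(compact_regular T_hausdorff T_compact (@filterT _ _ _))[W nW WU].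
exists W°; split; [exact: open_interior | exact: nW |].
by apply: subset_trans WU; apply: closureS; exact: interior_subset.
Qed.

Lemma nested_closed_nonempty (C : nat -> set T) :
  (forall n, closed (C n)) -> (forall n, C n.+1 `<=` C n) ->
  (forall n, C n !=set0) -> \bigcap_n C n !=set0.
Proof.
move=> Ccl Cdec Cn0.
have [c cC] := choice Cn0.
have Cle m n : (m <= n)%N -> C n `<=` C m.
  elim: n => [|n IHn]; first by rewrite leqn0 => /eqP ->.
  rewrite leq_eqVlt => /predU1P[-> //|]; rewrite ltnS => /IHn.
  by apply: subset_trans; exact: Cdec.
(* A cluster point of the selected sequence lies in every [C N], because the sequence is eventually
   in that closed set. *)
have [x [_ xc]] := @T_compact (c @ \oo) _ (@filterT _ _ _).
exists x => N _; apply: Ccl => V /(xc _ _) xV.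
suff /xV[y [Cy Vy]] : (c @ \oo) (C N) by exists y.
by exists N => // n /= /Cle; exact.
Qed.

(** Baire's argument: shrink open sets [U n] so that the closure of [U n.+1] lies in [U n] and
    misses [B n]. By compactness the closures have a common point, and it lies in no [B n]. *)
Lemma compact_hausdorff_not_meager : [set: T] !=set0 -> ~ meager [set: T].
Proof.
move=> T0 [B Bnd TB].
(* The premises stand under the existential so that choice yields one total selector; [set0] is the
   dummy value when they fail. *)
have /choice[g gP] (p : nat * set T) : exists W, open p.2 -> p.2 !=set0 ->
    [/\ open W, W !=set0, closure W `<=` p.2 & closure W `<=` ~` B p.1].
  case: p => n U /=.
  have [[oU [x Ux]]|nU] := pselect (open U /\ U !=set0); last first.
    by exists set0 => ? ?; case: nU.
  have [y [Uy By]] : (U `&` ~` closure (B n)) !=set0.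
    apply: contrapT => /set0P/negP; rewrite negbK => /eqP UB.
    have : (closure (B n))° x.
      rewrite /interior nbhsE; exists U => // z Uz; apply: contrapT => Bz.
      by have : set0 z by rewrite -UB.
    by rewrite Bnd.
  have oUB : open (U `&` ~` closure (B n)).
    by apply: openI => //; apply: closed_openC; exact: closed_closure.
  have [W [oW Wy WUB]] := closed_nbhs_shrink (open_nbhs_nbhs (conj oUB (conj Uy By))).
  exists W => _ _; split => //; first by exists y.
    by move=> z /WUB[].
  by move=> z /WUB[_ Bz] /subset_closure.
pose U := fix U n := if n is n'.+1 then g (n', U n') else setT.
have UP n : open (U n) /\ U n !=set0.
  by elim: n => [|n [/(gP (n, U n))/[apply]-[]]]; split=> //; exact: openT.
have gU n := gP (n, U n) (UP n).1 (UP n).2.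
have [x xU] : \bigcap_n closure (U n) !=set0.
  apply: nested_closed_nonempty => n; first exact: closed_closure.
    by case: (gU n) => _ _ /= + _ => /subset_trans; apply; exact: subset_closure.
  by case: (UP n) => _ [x Ux]; exists x; exact: subset_closure.
have [n _] := TB x I.
by case: (gU n) => _ _ _ /(_ x (xU n.+1 I)).
Qed.

Variable F : T -> T.
Hypothesis F_continuous : continuous F.

Definition global_attractor : set T := \bigcap_n range (iter n F).

Let iter_continuous n : continuous (iter n F).
Proof.
elim: n => [|n IHn] x; first exact: cvg_id.
exact: (@continuous_comp _ _ _ (iter n F) F x (IHn x) (@F_continuous _)).
Qed.

Let range_closed n : closed (range (iter n F)).
Proof.
apply: compact_closed => //; apply: continuous_compact => //.
by apply: continuous_subspaceT; exact: iter_continuous.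
Qed.

Let range_decreasing n : range (iter n.+1 F) `<=` range (iter n F).
Proof. by move=> _ [x _ <-]; exists (F x) => //; rewrite iterSr. Qed.

Lemma global_attractor_compact : compact global_attractor.
Proof.
by apply: closed_is_compact; apply: closed_bigI => n _; exact: range_closed.
Qed.

(** For surjectivity, the preimages of [a] lying in the successive ranges form a decreasing sequence
    of closed sets, nonempty because [a] is an image under each [n.+1]-st iterate. A point common to
    all of them is a preimage inside the attractor. *)
Lemma global_attractor_invariant : F @` global_attractor = global_attractor.
Proof.
apply/seteqP; split=> [_ [x Ax <-] n _|a Aa].
  by case: (Ax n I) => y _ <-; apply: range_decreasing; exists y.
suff [x xC] : \bigcap_n (range (iter n F) `&` F @^-1` [set a]) !=set0.
  by exists x => [n|]; [case: (xC n) | case: (xC 0)].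
apply: nested_closed_nonempty => n.
- apply: closedI; first exact: range_closed.
  apply: preimage_closed => [x _|]; first exact: F_continuous.
  exact: accessible_closed_set1 (hausdorff_accessible T_hausdorff) _.
- by move=> x [/range_decreasing].
- by case: (Aa n.+1 I) => y _ <-; exists (iter n F y); split => //; exists y.
Qed.

Lemma basin_global_attractor : basin F global_attractor = setT.
Proof.
apply/seteqP; split=> // x _ y; rewrite omega_limitE => yx n _.
apply: range_closed; apply: closureS (yx n I) => _ [m /= nm <-].
by rewrite -(subnKC nm) iterD; exists (iter (m - n) F x).
Qed.

Lemma omega_limit_meets_closure (x : T) (V : set T) :
  (forall N, exists2 n, (N <= n)%N & V (iter n F x)) ->
  omega_limit F x `&` closure V !=set0.
Proof.
move=> xV; rewrite omega_limitE.
suff [y yC] : \bigcap_N (closure [set iter n F x | n in [set n | (N <= n)%N]]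
    `&` closure V) !=set0.
  by exists y; split=> [N _|]; [case: (yC N I)|case: (yC 0 I)].
apply: nested_closed_nonempty => N.
- by apply: closedI; exact: closed_closure.
- apply: setSI; apply: closureS => _ [n /= Nn <-]; exists n => //=; exact: ltnW.
- have [n Nn Vn] := xV N; exists (iter n F x); split; apply: subset_closure => //.
  by exists n.
Qed.

(** Choose [a] in the attractor off [A'] and a neighborhood [V] of [a] whose closure misses [A'].
    Off a meager set every orbit enters [V] infinitely often, so its limit set meets [closure V] and
    is not contained in [A']. Hence the basin of [A'] is meager; were its complement meager too, the
    whole space would be. *)
Lemma global_attractor_Milnor : [set: T] !=set0 ->
  (forall a U V N, global_attractor a -> open U -> U !=set0 -> open V -> V a ->
    exists2 n, (N <= n)%N & exists2 x, U x & V (iter n F x)) ->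
  Milnor_topological_attractor F global_attractor.
Proof.
move=> T0 visits; have T_nmeager := compact_hausdorff_not_meager T0.
split; [exact: global_attractor_compact | exact: global_attractor_invariant | |].
  by rewrite basin_global_attractor.
move=> A' A'c _ [_ AA']; rewrite basin_global_attractor setTD.
have [a [Aa A'a]] : exists a, global_attractor a /\ ~ A' a.
  by apply: contrapT => nA; apply: AA' => a Aa; apply: contrapT => A'a; apply: nA; exists a.
have A'cl := compact_closed T_hausdorff A'c.
have [V [oV Va VA']] :=
  closed_nbhs_shrink (open_nbhs_nbhs (conj (closed_openC A'cl) A'a)).
(* Points that visit [V] at some time at least [N]: an open set, and a dense one by [visits]. *)
pose E N := \bigcup_(n in [set n | (N <= n)%N]) (iter n F @^-1` V).
have Eo N : open (E N).
  apply: bigcup_open => n _; apply: open_comp => // x _; exact: iter_continuous.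
have End N : nowhere_dense (~` E N).
  apply/seteqP; split=> // x; rewrite -(closure_id _).1; last exact: open_closedC.
  rewrite /interior nbhsE => -[U [oU Ux] UE].
  have [n Nn [y Uy Vy]] := visits a U V N Aa oU (ex_intro _ x Ux) oV Va.
  by apply: (UE _ Uy); exists n.
move=> [B Bnd BA']; apply: T_nmeager.
(* Two countable families are interleaved: odd indices cover the complement of the basin of [A'],
   even ones cover that basin. *)
exists (fun n => if odd n then B n./2 else ~` E n./2).
  by move=> n; case: ifP.
move=> x _; have [xA'|xA'] := pselect (basin F A' x); last first.
  by have [n _ Bx] := BA' x xA'; exists n.*2.+1 => //=; rewrite odd_double uphalf_double.
have [N nEx] : exists N, ~ E N x.
  apply: contrapT => nE.
  have [|y [/xA' A'y /VA' nA'y]] := @omega_limit_meets_closure x V; last exact: nA'y.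
  move=> N; apply: contrapT => nN; apply: nE; exists N => -[n Nn Vn].
  by apply: nN; exists n.
by exists N.*2 => //=; rewrite odd_double doubleK.
Qed.

End CompactDynamics.

(** * Periodicity and reduction modulo a full turn *)

Section PeriodicFunctions.
Variable R : realType.
Local Open Scope ring_scope.

Lemma periodicz (f : R -> R) (T : R) : periodic f T ->
  forall (k : int) (x : R), f (x + T *~ k) = f x.
Proof.
move=> fT [n|n] x; first exact: (periodicn fT).
by rewrite NegzE mulrNz -(periodicn fT n.+1 (x - _)) -addrA pmulrn addNr addr0.
Qed.

Lemma representative_mod_2pi (x : R) : exists k : int, 0 <= x - 2 * pi *~ k < 2 * pi.
Proof.
have pi20 : 0 < 2 * pi :> R by rewrite mulr_gt0 ?pi_gt0.
exists (Num.floor (x / (2 * pi))).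
have xE : x = x / (2 * pi) * (2 * pi) by rewrite divfK// gt_eqF.
rewrite -(mulrzl (2 * pi)) [X in X - _]xE -mulrBl.
have /andP[fl fr] := mem_rg1_floor (x / (2 * pi)).
apply/andP; split; first by rewrite mulr_ge0 ?subr_ge0 ?(ltW pi20).
by rewrite gtr_pMl// ltrBlDl.
Qed.

(** Reduce to [y] in [0, 2 pi). If [y] were positive, sin(y/2) would be positive and cos y = 1 - 2
    sin(y/2)^2 less than 1. *)
Lemma cos_eq1 (x : R) : cos x = 1 -> exists k : int, x = 2 * pi *~ k.
Proof.
have [k /andP[x0 x2pi]] := representative_mod_2pi x.
have -> : cos x = cos (x - 2 * pi *~ k).
  by rewrite -[in LHS](subrK (2 * pi *~ k) x) periodicz// mulr_natl; exact: cosD2pi.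
set y := x - _ in x0 x2pi * => cy; exists k; apply/eqP; rewrite -subr_eq0 -/y.
move: x0; rewrite le_eqVlt => /predU1P[<- //|y0].
have : 0 < sin (y / 2).
  apply: sin_gt0_pi; rewrite divr_gt0//= ltr_pdivrMr// mulrC; exact: x2pi.
have := cos_mulr2n (y / 2); rewrite -[y / 2 *+ 2]mulr_natr divfK ?pnatr_eq0// cy cos2sin2.
by move=> + s0; have := mulr_gt0 s0 s0; rewrite -mulr_natr; lra.
Qed.

End PeriodicFunctions.

(** * Smoothness of polynomials in the coordinates and in the cosine and sine of the angle *)

Section TrigonometricPolynomials.
Variable R : realType.
Local Notation cover := (R^o * (R^o * R^o))%type.
Local Open Scope ring_scope.

(* A class of functions stable under directional derivatives that contains the
   components of the lift of the skew product. *)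
Inductive trig_poly : (cover -> R^o) -> Prop :=
| trig_poly_cst k : trig_poly (fun=> k)
| trig_poly_angle : trig_poly (fun p => p.1)
| trig_poly_x : trig_poly (fun p => p.2.1)
| trig_poly_y : trig_poly (fun p => p.2.2)
| trig_poly_cos : trig_poly (fun p => cos p.1)
| trig_poly_sin : trig_poly (fun p => sin p.1)
| trig_polyD f g : trig_poly f -> trig_poly g -> trig_poly (fun p => f p + g p)
| trig_polyM f g : trig_poly f -> trig_poly g -> trig_poly (fun p => f p * g p).

Lemma trig_poly_ext (f g : cover -> R^o) : trig_poly g -> f =1 g -> trig_poly f.
Proof. by move=> + /funext ->. Qed.

(** Both claims go through one induction, since the sum and product rules for derivatives require
    differentiability of the operands. *)
Lemma trig_poly_differentiable (f : cover -> R^o) : trig_poly f ->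
  (forall x, differentiable f x) /\ forall v, trig_poly (fun x => 'D_v f x).
Proof.
(* The coordinate projections are linear, so their directional derivatives are constant. *)
have lin (l : {linear cover -> R^o}) : continuous l ->
    (forall x, differentiable l x) /\ forall v, trig_poly (fun x => 'D_v l x).
  move=> cl; have dl x : differentiable l x by exact: linear_differentiable.
  split=> // v; apply: (trig_poly_ext (trig_poly_cst (l v))) => x.
  by rewrite deriveE// diff_lin.
have [dt Dt] := lin (@fst _ _) (fun x => cvg_fst).
(* Chain rule for a function of the angle alone, which serves for cosine and sine. *)
have comp (h dh : R -> R) : (forall x : R, is_derive x 1 h (dh x)) ->
    trig_poly (fun p => dh p.1) ->
    (forall x, differentiable (fun p : cover => h p.1 : R^o) x) /\
    forall v, trig_poly (fun x => 'D_v (fun p : cover => h p.1 : R^o) x).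
  move=> hdh tdh.
  have dh' x : differentiable (h : R^o -> R^o) x by apply/derivable1_diffP; apply: ex_derive.
  have dc x := differentiable_comp (dt x) (dh' _).
  split=> // v; apply: (trig_poly_ext (trig_polyM tdh (trig_poly_cst v.1))) => x.
  rewrite deriveE; last exact: dc.
  rewrite (diff_comp (dt x) (dh' _)) /= diff1E// derive1E derive_val.
  rewrite (diff_lin (f := @fst _ _)); last by move=> ?; exact: cvg_fst.
  by rewrite /= mulrC.
elim=> {f} [k||||||f g _ [df Df] _ [dg Dg]|f g tf [df Df] tg [dg Dg]].
- split=> [x|v]; first exact: differentiable_cst.
  by apply: (trig_poly_ext (trig_poly_cst 0)) => x; rewrite derive_cst.
- exact: (lin (@fst _ _) (fun x => cvg_fst)).
- apply: (lin (@fst R^o R^o \o @snd R^o (R^o * R^o)%type)) => x.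
  by apply: continuous_comp; [exact: cvg_snd | exact: cvg_fst].
- apply: (lin (@snd R^o R^o \o @snd R^o (R^o * R^o)%type)) => x.
  by apply: continuous_comp; [exact: cvg_snd | exact: cvg_snd].
- apply: (comp _ (fun x => - sin x)).
  apply: (trig_poly_ext (trig_polyM (trig_poly_cst (-1)) trig_poly_sin)) => x.
  by rewrite mulN1r.
- exact: (comp _ _ _ trig_poly_cos).
- split=> [x|v]; first exact: differentiableD.
  apply: (trig_poly_ext (trig_polyD (Df v) (Dg v))) => x.
  by rewrite deriveD//; exact: diff_derivable.
- split=> [x|v]; first exact: differentiableM.
  apply: (trig_poly_ext (trig_polyD (trig_polyM tf (Dg v)) (trig_polyM tg (Df v)))) => x.
  by rewrite deriveM//; exact: diff_derivable.
Qed.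

(** Induction on the order: the derivative of a triple is the triple of derivatives, whose
    components are again in the class. *)
Lemma trig_poly_smooth (f g h : cover -> R^o) :
  trig_poly f -> trig_poly g -> trig_poly h ->
  smooth_on setT (fun p => (f p, (g p, h p)) : cover).
Proof.
move=> tf tg th n; elim: n f g h tf tg th => [|n IHn] f g h tf tg th;
  have [df Df] := trig_poly_differentiable tf;
  have [dg Dg] := trig_poly_differentiable tg;
  have [dh Dh] := trig_poly_differentiable th;
  have dgh x := differentiable_pair (dg x) (dh x);
  have dfgh x := differentiable_pair (df x) (dgh x).
  by move=> x _; apply: differentiable_continuous; exact: dfgh.
split=> [x _|v]; first exact: dfgh.
rewrite (_ : (fun x => 'D_v _ x) = fun x => ('D_v f x, ('D_v g x, 'D_v h x))).
  exact: IHn.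
apply/funext => x; rewrite deriveE; last exact: dfgh.
by rewrite (diff_pair (df x) (dgh x)) (diff_pair (dg x) (dh x)) !deriveE.
Qed.

End TrigonometricPolynomials.

(** * Topology of the circle, the disk and the solid torus *)

Section OctuplingSkewProduct.
Variable R : realType.
Local Notation circle := (circle R).
Local Notation disk := (@disk R).
Local Notation solid_torus := (solid_torus R).
Local Open Scope ring_scope.
Local Open Scope quotient_scope.

Definition circle_cos (phi : circle) : R := cos (repr phi).
Definition circle_sin (phi : circle) : R := sin (repr phi).

Lemma periodic_pi_circle (f : R -> R) (s t : R) : periodic f (pi *+ 2) ->
  \pi_circle s = \pi_circle t -> f s = f t.
Proof.
move=> fT /pi_circle_eq[k stk].
by rewrite -(subrK t s) stk addrC periodicz// mulr_natl.
Qed.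

Lemma circle_cosE (t : R) : circle_cos (\pi_circle t) = cos t.
Proof. by apply: periodic_pi_circle; [exact: cosD2pi | exact: reprK]. Qed.

Lemma circle_sinE (t : R) : circle_sin (\pi_circle t) = sin t.
Proof. by apply: periodic_pi_circle; [exact: sinD2pi | exact: reprK]. Qed.

Lemma circle_cos_continuous : continuous circle_cos.
Proof.
apply: (@repr_comp_continuous _ _ _ (cos : R -> R)); first exact: continuous_cos.
move=> s t /eqP st; apply/eqP; apply: periodic_pi_circle st; exact: cosD2pi.
Qed.

Lemma circle_sin_continuous : continuous circle_sin.
Proof.
apply: (@repr_comp_continuous _ _ _ (sin : R -> R)); first exact: continuous_sin.
move=> s t /eqP st; apply/eqP; apply: periodic_pi_circle st; exact: sinD2pi.
Qed.

(** The difference of the two representatives has cosine c^2 + s^2 = 1, hence is a multiple of 2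
    pi. *)
Lemma circle_cos_sin_inj (phi psi : circle) :
  circle_cos phi = circle_cos psi -> circle_sin phi = circle_sin psi -> phi = psi.
Proof.
rewrite /circle_cos /circle_sin => c s; rewrite -(reprK phi) -(reprK psi).
apply/pi_circle_eq/cos_eq1.
by rewrite cosB c s -!expr2 cos2Dsin2.
Qed.

Lemma circle_ex (phi : circle) : exists2 t : R, 0 <= t <= 2 * pi & \pi_circle t = phi.
Proof.
have [k /andP[t0 t1]] := representative_mod_2pi (repr phi).
exists (repr phi - 2 * pi *~ k); first by rewrite t0 ltW.
rewrite -[RHS]reprK; apply/pi_circle_eq; exists (- k).
by rewrite mulrNz addrAC subrr add0r.
Qed.

Local Notation sqnorm p := (p.1 ^+ 2 + p.2 ^+ 2).

(** Outside the disk this is inversion in the unit circle, which avoids the square root of the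
    radial projection. *)
Definition retraction_val (p : R^o * R^o) : R^o * R^o :=
  (p.1 / Num.max 1 (sqnorm p), p.2 / Num.max 1 (sqnorm p)).

Fact retraction_subproof p : retraction_val p \in disk.
Proof.
apply/mem_set; rewrite /disk /retraction_val /= !exprMn -mulrDl.
set s := sqnorm p; have s0 : 0 <= s by rewrite addr_ge0 ?sqr_ge0.
have m0 : 0 < Num.max 1 s by rewrite lt_max ltr01.
rewrite exprVn ler_pdivrMr ?exprn_gt0// mul1r.
have [s1|s1] := leP s 1; first by rewrite expr1n.
by rewrite expr2 ler_peMr// ltW.
Qed.

(* Extending the projection to the disk to the whole plane lets points of the
   subtype [disk] be written without membership proofs. *)
Definition disk_retraction (p : R^o * R^o) : disk := SigSub (retraction_subproof p).

Lemma disk_retractionE (p : R^o * R^o) : disk p -> val (disk_retraction p) = p.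
Proof.
by move=> p1; rewrite /= /retraction_val (max_idPl p1) !divr1; case: p {p1}.
Qed.

Lemma disk_retractionK (x : disk) : disk_retraction (val x) = x.
Proof. by apply/val_inj; rewrite disk_retractionE//; exact: set_valP. Qed.

Lemma disk_coord_itv (x : disk) : -1 <= (val x).1 <= 1 /\ -1 <= (val x).2 <= 1.
Proof. by have := set_valP x; rewrite /disk /= => x1; split; nra. Qed.

Lemma disk_val_continuous : continuous (val : disk -> R^o * R^o).
Proof. exact: initial_continuous. Qed.

Lemma disk_retraction_continuous : continuous disk_retraction.
Proof.
apply: continuous_comp_initial => p.
have c1 : {for p, continuous (fun p : R^o * R^o => p.1)} by exact: cvg_fst.
have c2 : {for p, continuous (fun p : R^o * R^o => p.2)} by exact: cvg_snd.
have cm : {for p, continuous (fun p : R^o * R^o => Num.max 1 (sqnorm p))}.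
  apply: continuous_max; first exact: cvg_cst.
  exact: (continuousD (continuousM c1 c1) (continuousM c2 c2)).
have m0 : Num.max 1 (sqnorm p) != 0 by rewrite gt_eqF// lt_max ltr01.
have cV := @continuousV _ _ (fun p : R^o * R^o => Num.max 1 (sqnorm p)) p m0 cm.
exact: (cvg_pair (continuousM c1 cV) (continuousM c2 cV)).
Qed.

(** The solid torus is a continuous image of the box [0, 2 pi] x [-1, 1]^2; the retraction takes
    care of the corners outside the disk. *)
Lemma solid_torus_compact : compact [set: solid_torus].
Proof.
pose q (p : R * (R^o * R^o)) : solid_torus := (\pi_circle p.1, disk_retraction p.2).
pose K : set (R * (R^o * R^o)) := `[0, 2 * pi] `*` (`[-1, 1] `*` `[-1, 1]).
have -> : [set: solid_torus] = q @` K.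
  apply/seteqP; split=> // -[phi x] _; have [t t2pi <-] := circle_ex phi.
  exists (t, val x); last by rewrite /q /= disk_retractionK.
  have [x1 x2] := disk_coord_itv x.
  by split=> /=; [rewrite in_itv | split; rewrite /= in_itv].
have Kc : compact K.
  have Ic (a b : R) : compact (`[a, b] : set R^o) := @segment_compact _ a b.
  exact: (compact_setX (Ic _ _) (compact_setX (Ic _ _) (Ic _ _))).
apply: continuous_compact Kc.
apply: continuous_subspaceT => p.
have c1 : {for p, continuous (fun p : R * (R^o * R^o) => \pi_circle p.1)}.
  by apply: continuous_comp; [exact: cvg_fst | exact: pi_continuous].
have c2 : {for p, continuous (fun p : R * (R^o * R^o) => disk_retraction p.2)}.
  by apply: continuous_comp; [exact: cvg_snd | exact: disk_retraction_continuous].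
exact: (cvg_pair c1 c2).
Qed.

(** Cosine, sine and the disk coordinates inject the solid torus continuously into a normed
    space. *)
Lemma solid_torus_hausdorff : hausdorff_space solid_torus.
Proof.
pose h (q : solid_torus) : R * R * (R * R) :=
  (circle_cos q.1, circle_sin q.1, val q.2).
apply: (@hausdorff_inj _ _ h).
- move=> q.
  have cc : {for q, continuous (fun q : solid_torus => circle_cos q.1)}.
    by apply: continuous_comp; [exact: cvg_fst | exact: circle_cos_continuous].
  have cs : {for q, continuous (fun q : solid_torus => circle_sin q.1)}.
    by apply: continuous_comp; [exact: cvg_fst | exact: circle_sin_continuous].
  have cv : {for q, continuous (fun q : solid_torus => val q.2)}.
    by apply: continuous_comp; [exact: cvg_snd | exact: disk_val_continuous].
  exact: (cvg_pair (cvg_pair cc cs) cv).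
- move=> [phi x] [psi y] [c s /val_inj ->].
  by rewrite (circle_cos_sin_inj c s).
- exact: norm_hausdorff.
Qed.

(** * The fiber maps and the skew product *)

Definition weight (c s : R) : R := 9 / 10 * (1 - (c ^+ 2 - s ^+ 2) ^+ 6).

Definition fiber_map (c s : R) (p : R^o * R^o) : R^o * R^o :=
  (weight c s * p.1 + (1 - weight c s) * (c / 2),
   weight c s * p.2 + (1 - weight c s) * (s / 2)).

Lemma weight_ge0 c s : c ^+ 2 + s ^+ 2 = 1 -> 0 <= weight c s.
Proof.
move=> cs; rewrite /weight mulr_ge0// subr_ge0 -[6%N]/(2 * 3)%N exprM exprn_ile1 ?sqr_ge0//.
nra.
Qed.

Lemma weight_le c s : weight c s <= 9 / 10.
Proof.
have := sqr_ge0 ((c ^+ 2 - s ^+ 2) ^+ 3); rewrite -exprM /weight; lra.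
Qed.

(** The image is a convex combination of [p] and (c/2, s/2), both in the disk; convexity of the
    square, coordinate by coordinate, suffices. *)
Lemma fiber_map_disk c s p : c ^+ 2 + s ^+ 2 = 1 -> disk p -> disk (fiber_map c s p).
Proof.
move=> cs; rewrite /disk /fiber_map /=.
have := weight_ge0 cs; have := weight_le c s; set w := weight c s => w1 w0 p1.
have sqr_convex a b : (w * a + (1 - w) * b) ^+ 2 <= w * a ^+ 2 + (1 - w) * b ^+ 2.
  rewrite -subr_ge0 (_ : _ - _ = w * (1 - w) * (a - b) ^+ 2); last by ring.
  by rewrite mulr_ge0 ?sqr_ge0// mulr_ge0//; lra.
have := sqr_convex p.1 (c / 2); have := sqr_convex p.2 (s / 2).
rewrite !exprMn; nra.
Qed.

Definition skew_map (q : solid_torus) : solid_torus :=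
  (octupling q.1,
   disk_retraction (fiber_map (circle_cos q.1) (circle_sin q.1) (val q.2))).

Lemma skew_map_val q :
  val (skew_map q).2 = fiber_map (circle_cos q.1) (circle_sin q.1) (val q.2).
Proof.
apply: disk_retractionE; apply: fiber_map_disk; first exact: cos2Dsin2.
exact: set_valP.
Qed.

Lemma octupling_continuous : continuous (@octupling R).
Proof.
apply/quotient_continuous; rewrite (_ : _ \o _ = \pi_circle \o (fun t : R => 8 * t)).
  by move=> t; apply: continuous_comp; [exact: mulrl_continuous | exact: pi_continuous].
by apply/funext => t; exact: octupling_pi.
Qed.

Lemma skew_map_continuous : continuous skew_map.
Proof.
move=> q.
have co : {for q, continuous (fun q : solid_torus => octupling q.1)}.
  by apply: continuous_comp; [exact: cvg_fst | exact: octupling_continuous].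
pose c (q : solid_torus) := circle_cos q.1.
pose s (q : solid_torus) := circle_sin q.1.
have cc : {for q, continuous c}.
  by apply: continuous_comp; [exact: cvg_fst | exact: circle_cos_continuous].
have cs : {for q, continuous s}.
  by apply: continuous_comp; [exact: cvg_fst | exact: circle_sin_continuous].
have cv : {for q, continuous (fun q : solid_torus => val q.2)}.
  by apply: continuous_comp; [exact: cvg_snd | exact: disk_val_continuous].
have cx : {for q, continuous (fun q : solid_torus => (val q.2).1)}.
  by apply: (continuous_comp cv); exact: cvg_fst.
have cy : {for q, continuous (fun q : solid_torus => (val q.2).2)}.
  by apply: (continuous_comp cv); exact: cvg_snd.
have ck (k : R) : {for q, continuous (fun=> k)} by exact: cvg_cst.
have cw : {for q, continuous (fun q => weight (c q) (s q))}.
  have cd := continuousB (continuousM cc cc) (continuousM cs cs).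
  have cd6 := @continuous_comp _ _ _ _ (fun x : R => x ^+ 6) q cd (@exprn_continuous _ _ _).
  exact: (continuousM (ck (9 / 10)) (continuousB (ck 1) cd6)).
have c1w := continuousB (ck 1) cw.
have cf : {for q, continuous (fun q => fiber_map (c q) (s q) (val q.2))}.
  exact: (cvg_pair
    (continuousD (continuousM cw cx) (continuousM c1w (continuousM cc (ck 2^-1))))
    (continuousD (continuousM cw cy) (continuousM c1w (continuousM cs (ck 2^-1))))).
exact: (cvg_pair co (continuous_comp cf (@disk_retraction_continuous _))).
Qed.

Lemma skew_map_pi_val (t : R) (x : disk) :
  val (skew_map (\pi_circle t, x)).2 = fiber_map (cos t) (sin t) (val x).
Proof. by rewrite skew_map_val circle_cosE circle_sinE. Qed.

Lemma iter_skew_map_pi n (t : R) (x : disk) :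
  (iter n skew_map (\pi_circle t, x)).1 = \pi_circle (8 ^+ n * t).
Proof.
elim: n => [|n IHn] /=; first by rewrite mul1r.
by rewrite IHn octupling_pi mulrA -exprS.
Qed.

Lemma circle_cos2Dsin2 (phi : circle) : circle_cos phi ^+ 2 + circle_sin phi ^+ 2 = 1.
Proof. exact: cos2Dsin2. Qed.

(** * Contraction along the fibers *)

Definition fiber_dist (x y : disk) : R :=
  Num.max `|(val x).1 - (val y).1| `|(val x).2 - (val y).2|.

Lemma skew_map_contracts (phi : circle) (x y : disk) :
  fiber_dist (skew_map (phi, x)).2 (skew_map (phi, y)).2 <= 9 / 10 * fiber_dist x y.
Proof.
rewrite /fiber_dist !skew_map_val /=.
have w0 := weight_ge0 (circle_cos2Dsin2 phi).
have := weight_le (circle_cos phi) (circle_sin phi).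
move: w0; move: (weight _ _) => w w0 w1.
have cancel (k a b c : R) : k * a + c - (k * b + c) = k * (a - b) by ring.
rewrite !cancel !normrM (ger0_norm w0) -maxr_pMr//.
by rewrite ler_wpM2r// le_max normr_ge0.
Qed.

(** The base angle evolves independently of the fiber point, so the one-step contraction iterates; 2
    bounds the diameter of the disk for [fiber_dist]. *)
Lemma iter_skew_map_contracts n (phi : circle) (x y : disk) :
  (iter n skew_map (phi, x)).1 = (iter n skew_map (phi, y)).1 /\
  fiber_dist (iter n skew_map (phi, x)).2 (iter n skew_map (phi, y)).2
    <= (9 / 10) ^+ n * 2.
Proof.
elim: n => [|n [IHb IHf]] /=.
  rewrite mul1r; split=> //; rewrite /fiber_dist.
  have [/andP[? ?] /andP[? ?]] := disk_coord_itv x.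
  have [/andP[? ?] /andP[? ?]] := disk_coord_itv y.
  by rewrite ge_max !ler_norml; lra.
split; first by rewrite IHb.
rewrite exprS -mulrA.
have c0 : 0 <= 9 / 10 :> R by lra.
apply: le_trans (ler_wpM2l c0 IHf).
have := skew_map_contracts (iter n skew_map (phi, x)).1
  (iter n skew_map (phi, x)).2 (iter n skew_map (phi, y)).2.
by rewrite {2}IHb -!surjective_pairing.
Qed.

Lemma geometric_9_10_lt (e : R) : 0 < e -> exists k, (9 / 10) ^+ k * 2 < e.
Proof.
move=> e0.
have c0 : 0 <= 9 / 10 :> R by lra.
have c1 : `|9 / 10 : R| < 1 by rewrite ger0_norm//; lra.
have /cvgrPdist_lt/(_ (e / 2)) := cvg_expr c1.
case=> [|k _ /(_ k (leqnn k))]; first lra.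
by rewrite /= sub0r normrN ger0_norm ?exprn_ge0// => ?; exists k; lra.
Qed.

Local Notation attractor := (global_attractor skew_map).

(** One step sends x - 1/2 to w (x - 1/2) + (1 - w) (c - 1)/2, at most w (x - 1/2) with w at most
    9/10. As a point of the attractor is a [k]-th iterate for every [k], its excess over 1/2 is at
    most (9/10)^k for all [k]. *)
Lemma attractor_fst_le q : attractor q -> (val q.2).1 <= 1 / 2 :> R.
Proof.
move=> Aq; apply/ler_addgt0Pl => e e0.
have [k ke] := geometric_9_10_lt e0.
have [q0 _ <-] := Aq k I.
suff : (val (iter k skew_map q0).2).1 - 1 / 2 <= (9 / 10) ^+ k :> R.
  have : 0 <= (9 / 10) ^+ k :> R by rewrite exprn_ge0//; lra.
  lra.
elim: k {ke} => [|k IHk].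
  by have [/andP[_ ?] _] := disk_coord_itv q0.2; lra.
rewrite iterS skew_map_val /fiber_map [_.1]/=; set p := iter k skew_map q0 in IHk *.
have w0 := weight_ge0 (circle_cos2Dsin2 p.1).
have w1 := weight_le (circle_cos p.1) (circle_sin p.1).
have c1 : circle_cos p.1 <= 1 by exact: cos_le1.
rewrite exprS; have : 0 <= (9 / 10) ^+ k :> R by rewrite exprn_ge0//; lra.
move: w0 w1 IHk; move: (weight _ _) (val p.2).1 (_ ^+ k) => w y l w0 w1 IHk l0.
nra.
Qed.

(** * A square in every fiber of the attractor *)

(* Adding pi/4 to psi exchanges cos(2 psi)^2 and sin(2 psi)^2; adding pi/2 then
   permutes the quadrants. *)
Lemma preimage_in_quadrant (a b : bool) (t : R) : exists psi : R,
  [/\ \pi_circle (8 * psi) = \pi_circle t,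
      (cos psi ^+ 2 - sin psi ^+ 2) ^+ 2 <= 1 / 2,
      0 < (-1) ^+ a * cos psi & 0 < (-1) ^+ b * sin psi].
Proof.
pose D (x : R) := cos x ^+ 2 - sin x ^+ 2.
pose good x := \pi_circle (8 * x) = \pi_circle t /\ D x ^+ 2 <= 1 / 2.
have DE x : D x = cos (x *+ 2) by rewrite /D cos_mulr2n sin2cos2; ring.
have [x gx] : exists x, good x.
  have [D0|D0] := leP (D (t / 8) ^+ 2) (1 / 2).
    by exists (t / 8); split=> //; congr (\pi_circle _); field.
  (* Eight times pi/4 is one full turn, so the shifted angle is still a preimage of [t]. *)
  exists (t / 8 + pi / 2 / 2); split.
    by apply/pi_circle_eq; exists 1; field.
  move: D0; rewrite !DE mulrnDl -(mulr_natr (pi / 2 / 2)) divfK ?pnatr_eq0//.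
  by rewrite cosDpihalf sqrrN sin2cos2; lra.
have rot y : good y -> good (y + pi / 2).
  case=> py Dy; split; last by move: Dy; rewrite /D cosDpihalf sinDpihalf; nra.
  by rewrite -py; apply/pi_circle_eq; exists 2; field.
have [y [gy cy sy]] : exists y, [/\ good y, 0 < cos y & 0 < sin y].
  have cs := cos2Dsin2 x.
  have [_ Dx] := gx.
  (* On the coordinate axes [D x ^+ 2] equals 1, so the bound 1/2 keeps [x] strictly inside a
     quadrant. *)
  have c0 : cos x != 0 by apply: contra_leN Dx => /eqP c0; rewrite /D; nra.
  have s0 : sin x != 0 by apply: contra_leN Dx => /eqP s0; rewrite /D; nra.
  have [c|c|/eqP] := ltrgt0P (cos x); last by rewrite (negPf c0).
    have [s|s|/eqP] := ltrgt0P (sin x); last by rewrite (negPf s0).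
      by exists x.
    by exists (x + pi / 2); split; [exact: rot | |];
      rewrite ?cosDpihalf ?sinDpihalf ?oppr_gt0.
  have [s|s|/eqP] := ltrgt0P (sin x); last by rewrite (negPf s0).
    by exists (x + pi / 2 + pi / 2 + pi / 2); split; [exact: rot _ (rot _ (rot _ gx)) | |];
      rewrite ?(cosDpihalf, sinDpihalf) ?opprK ?oppr_gt0.
  by exists (x + pi / 2 + pi / 2); split; [exact: rot _ (rot _ gx) | |];
    rewrite ?(cosDpihalf, sinDpihalf) ?oppr_gt0.
case: a b => -[]; rewrite ?expr1 ?expr0.
- exists (y + pi / 2 + pi / 2); have [? ?] := rot _ (rot _ gy).
  by split=> //; rewrite ?(cosDpihalf, sinDpihalf) ?mulN1r ?opprK.
- exists (y + pi / 2); have [? ?] := rot _ gy.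
  by split=> //; rewrite ?(cosDpihalf, sinDpihalf) ?mulN1r ?opprK ?mul1r.
- exists (y + pi / 2 + pi / 2 + pi / 2); have [? ?] := rot _ (rot _ (rot _ gy)).
  by split=> //; rewrite ?(cosDpihalf, sinDpihalf) ?mulN1r ?opprK ?mul1r.
- by exists y; have [? ?] := gy; split=> //; rewrite ?mul1r.
Qed.

(** The sixth power is at most (1/2)^3 = 1/8, and 9/10 times 7/8 is 63/80. *)
Lemma weight_ge (c s : R) : (c ^+ 2 - s ^+ 2) ^+ 2 <= 1 / 2 -> 63 / 80 <= weight c s.
Proof.
move=> d; have d0 := sqr_ge0 (c ^+ 2 - s ^+ 2).
have : ((c ^+ 2 - s ^+ 2) ^+ 2) ^+ 3 <= (1 / 2) ^+ 3 by rewrite lerXn2r// nnegrE; lra.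
by rewrite -exprM /weight; lra.
Qed.

(** If c were below 1/3, then (1 - 2 c^2)^2 would be at least (7/9)^2 = 49/81, which exceeds 1/2. *)
Lemma coord_ge (c s : R) : c ^+ 2 + s ^+ 2 = 1 ->
  (c ^+ 2 - s ^+ 2) ^+ 2 <= 1 / 2 -> 0 < c -> 1 / 3 <= c.
Proof.
move=> cs d c0; rewrite leNgt; apply/negP => c1; move: d; apply/negP; rewrite -ltNge.
have -> : s ^+ 2 = 1 - c ^+ 2 by lra.
have c2 : c ^+ 2 <= 1 / 9 by nra.
set e := c ^+ 2 in c2 *; nra.
Qed.

(** The inverse branch keeps a coordinate within 1/6 when [x] and [c] have the same sign. Up to that
    sign, the upper bound needs c/2 to be at least 1/6, whence the 1/3; the lower bound needs (1 -
    w)/2 to be at most w/6, that is w at least 3/4, which 63/80 ensures. *)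
Lemma affine_preimage_bound (e : bool) (w c x : R) : 63 / 80 <= w <= 9 / 10 ->
  1 / 3 <= (-1) ^+ e * c <= 1 -> 0 <= (-1) ^+ e * x <= 1 / 6 ->
  `|(x - (1 - w) * (c / 2)) / w| <= 1 / 6.
Proof.
move=> /andP[w0 w1]; have wp : 0 < w by lra.
rewrite ler_norml (ler_pdivlMr _ _ wp) (ler_pdivrMr _ _ wp).
set d := (-1) ^+ e * c => /andP[c0 c1].
have h1 : 0 <= (1 - w) * (d - 1 / 3) by rewrite mulr_ge0; lra.
have h2 : 0 <= (1 - w) * (1 - d) by rewrite mulr_ge0; lra.
move: h1 h2; rewrite /d.
by case: e {d c0 c1}; rewrite ?expr1 ?expr0 ?mulN1r ?mul1r => h1 h2 /andP[x0 x1]; lra.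
Qed.

Lemma disk_small_coord (u v : R) : `|u| <= 1 / 6 -> `|v| <= 1 / 6 -> disk (u, v).
Proof. by rewrite /disk /= !ler_norml => /andP[? ?] /andP[? ?]; nra. Qed.

Definition square : set solid_torus :=
  [set q | `|(val q.2).1| <= 1 / 6 /\ `|(val q.2).2| <= 1 / 6].

(** Over a preimage angle whose direction lies in the quadrant of [x], the inverse of the fiber map
    sends [x] back into the square. *)
Lemma square_sub_image : square `<=` skew_map @` square.
Proof.
move=> [phi x] [/= x1 x2]; have [t _ <-] := circle_ex phi.
have sgn (y : R) : `|y| <= 1 / 6 -> 0 <= (-1) ^+ (y < 0)%R * y <= 1 / 6.
  by rewrite -normrEsign normr_ge0.
have [psi [psit d c0 s0]] := preimage_in_quadrant ((val x).1 < 0) ((val x).2 < 0) t.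
have := sgn _ x1; have := sgn _ x2.
move: (_ < 0) (_ < 0) c0 s0 => b a c0 s0 bx2 ax1.
have w : 63 / 80 <= weight (cos psi) (sin psi) <= 9 / 10.
  by rewrite weight_ge// weight_le.
have sq e (u : R) : ((-1) ^+ e * u) ^+ 2 = u ^+ 2.
  by rewrite exprMn -exprM mulnC exprM sqrrN !expr1n mul1r.
have bound (e : bool) (u v : R) : u ^+ 2 + v ^+ 2 = 1 ->
    (u ^+ 2 - v ^+ 2) ^+ 2 <= 1 / 2 -> 0 < (-1) ^+ e * u ->
    1 / 3 <= (-1) ^+ e * u <= 1.
  move=> uv duv u0; rewrite (@coord_ge _ v) ?sq//=.
  have := sq e u; nra.
have cb := bound a _ _ (cos2Dsin2 psi) d c0.
(* Exchanging cosine and sine only changes the sign of the difference of squares. *)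
have sb : 1 / 3 <= (-1) ^+ b * sin psi <= 1.
  apply: (bound b _ (cos psi)) => //; first by rewrite addrC cos2Dsin2.
  by rewrite -sqrrN opprB.
have y1 := affine_preimage_bound w cb ax1.
have y2 := affine_preimage_bound w sb bx2.
have /andP[w0 w1] := w; have wn0 : weight (cos psi) (sin psi) != 0 by rewrite gt_eqF//; lra.
set y : R^o * R^o := (((val x).1 - (1 - weight (cos psi) (sin psi)) * (cos psi / 2))
    / weight (cos psi) (sin psi),
  ((val x).2 - (1 - weight (cos psi) (sin psi)) * (sin psi / 2))
    / weight (cos psi) (sin psi)).
have dy : disk y by exact: disk_small_coord.
exists (\pi_circle psi, disk_retraction y).
  by rewrite /square /mkset [\val _](disk_retractionE dy).
apply: injective_projections; first by rewrite /= octupling_pi.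
apply/val_inj; rewrite skew_map_pi_val disk_retractionE// /fiber_map /y /=.
by apply: injective_projections; rewrite /= mulrC divfK// subrK.
Qed.

Lemma square_sub_attractor : square `<=` attractor.
Proof.
move=> q Sq n _.
suff [q' _ <-] : (iter n skew_map @` square) q by exists q'.
elim: n q Sq => [|n IHn] q Sq; first by exists q.
have [q1 Sq1 <-] := square_sub_image Sq; have [q2 Sq2 <-] := IHn _ Sq1.
by exists q2.
Qed.

(** * Orbits from any open set approach any point of the attractor *)

(* Write a = F^k(b); by expansion, some point of U has an iterate exactly on the
   fiber of b, and k further steps bring it within 2 (9/10)^k of a. *)
Lemma iter_skew_map_visits (a : solid_torus) (U V : set solid_torus) N :
  attractor a -> open U -> U !=set0 -> open V -> V a ->
  exists2 n, (N <= n)%N & exists2 x, U x & V (iter n skew_map x).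
Proof.
move=> Aa oU [[phi x] Ux] oV Va.
have [t _ phit] := circle_ex phi; subst phi.
have [d d0 dU] : exists2 d : R, 0 < d & forall s, `|t - s| < d -> U (\pi_circle s, x).
  have ct : {for t, continuous (fun s : R => (\pi_circle s, x) : solid_torus)}.
    have c1 : {for t, continuous (fun s : R => \pi_circle s)} by exact: pi_continuous.
    have c2 : {for t, continuous (fun _ : R => x)} by exact: cvg_cst.
    exact: (cvg_pair c1 c2).
  have /nbhs_ballP[d /= d0 dU] := ct _ (open_nbhs_nbhs (conj oU Ux)).
  by exists d => // s; exact: dU.
have [e e0 eV] : exists2 e : R, 0 < e &
    forall y : disk, fiber_dist a.2 y < e -> V (a.1, y).
  (* Composing with the retraction replaces a neighborhood in the subtype by a ball of the plane,
     which is a ball for the sup distance. *)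
  have ca : {for (val a.2), continuous (fun p => (a.1, disk_retraction p) : solid_torus)}.
    have c1 : {for (val a.2), continuous (fun _ : R^o * R^o => a.1)} by exact: cvg_cst.
    exact: (cvg_pair c1 (@disk_retraction_continuous _)).
  have Va' : nbhs ((a.1, disk_retraction (val a.2)) : solid_torus) V.
    by rewrite disk_retractionK -surjective_pairing; apply: open_nbhs_nbhs.
  have /nbhs_ballP[e /= e0 eV] := ca _ Va'.
  exists e => // y; rewrite /fiber_dist gt_max => /andP[y1 y2].
  by rewrite -(disk_retractionK y); apply: eV; split.
have [k ke] := geometric_9_10_lt e0.
have [b _ ba] := Aa k I.
have [s _ sb] := circle_ex b.1.
(* After [m] steps an arc of length [d] is stretched beyond a full turn. *)
have [m [Nm md]] : exists m, (N <= m)%N /\ 2 * pi < d * 8 ^+ m.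
  have pid0 : 0 <= 2 * pi / d by rewrite divr_ge0 ?ltW// mulr_gt0// pi_gt0.
  have := archi_boundP pid0; set n := Num.bound _ => dn.
  exists (maxn N n); split; first exact: leq_maxl.
  rewrite (mulrC d) -ltr_pdivrMr//; apply: lt_le_trans dn _.
  by rewrite -natrX ler_nat (leq_trans (leq_maxr N n))// ltnW// ltn_expl.
have [j /andP[j0 j1]] := representative_mod_2pi (8 ^+ m * t - s).
(* The angle 8^m u is the lift of [s] lying less than one turn below 8^m t; hence t - u is
   nonnegative and less than [d]. *)
pose u : R := (s + 2 * pi *~ j) / 8 ^+ m.
have m0 : 0 < 8 ^+ m :> R by rewrite exprn_gt0.
have ub : (iter m skew_map (\pi_circle u, x)).1 = b.1.
  rewrite iter_skew_map_pi -sb; apply/pi_circle_eq; exists j.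
  by rewrite /u mulrC divfK ?gt_eqF// addrAC subrr add0r.
exists (k + m)%N; first by rewrite (leq_trans Nm)// leq_addl.
exists (\pi_circle u, x).
  apply: dU; have tu : (t - u) * 8 ^+ m = 8 ^+ m * t - s - 2 * pi *~ j.
    by rewrite mulrBl /u divfK ?gt_eqF// mulrC opprD addrA.
  have tu0 : 0 <= t - u by rewrite -(pmulr_lge0 _ m0) tu.
  by rewrite ger0_norm// -(ltr_pM2r m0) tu; apply: lt_trans j1 md.
rewrite iterD [iter m _ _]surjective_pairing ub.
have [Hb Hf] := iter_skew_map_contracts k b.1 b.2 (iter m skew_map (\pi_circle u, x)).2.
rewrite -surjective_pairing ba in Hb Hf.
rewrite [iter k _ _]surjective_pairing -Hb; apply: eV.
exact: le_lt_trans Hf ke.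
Qed.

(** * Failure of forward invariance, and smoothness of the map *)

Lemma skew_map_interior : ~ (skew_map @` attractor° `<=` attractor°).
Proof.
move=> /(_ (skew_map (\pi_circle 0, disk_retraction (0, 0)))) FA.
have d0 : disk (0, 0) by rewrite /disk /= expr0n addr0 ler01.
have {FA} : attractor° (skew_map (\pi_circle 0, disk_retraction (0, 0))).
  apply: FA; exists (\pi_circle 0, disk_retraction (0, 0)) => //.
  apply: (filterS square_sub_attractor).
  have cv : {for (\pi_circle 0, disk_retraction (0, 0)),
      continuous (fun q : solid_torus => val q.2)}.
    by apply: continuous_comp; [exact: cvg_snd | exact: disk_val_continuous].
  apply: (cv [set p : R^o * R^o | `|p.1| <= 1 / 6 /\ `|p.2| <= 1 / 6]).
  rewrite disk_retractionE//; apply/nbhs_ballP.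
  exists (1 / 6) => /=; first lra.
  by move=> p []; rewrite /ball /= !sub0r !normrN => /ltW ? /ltW.
have d1 : disk (1 / 2, 0) by rewrite /disk /= expr0n addr0; lra.
have -> : skew_map (\pi_circle 0, disk_retraction (0, 0)) =
    (\pi_circle 0, disk_retraction (1 / 2, 0)).
  apply: injective_projections; first by rewrite /= octupling_pi mulr0.
  apply/val_inj; rewrite skew_map_pi_val !disk_retractionE// /fiber_map /weight cos0 sin0 /=.
  by congr (_, _); field.
(* A path leaving the image point in the direction of increasing x, where the half-space bound on
   the attractor fails at once. *)
pose h (e : R) : solid_torus := (\pi_circle 0, disk_retraction (1 / 2 + e, 0)).
have ch : {for 0, continuous h}.
  have c1 : {for 0, continuous (fun _ : R => \pi_circle 0)} by exact: cvg_cst.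
  have c2 : {for 0, continuous (fun e : R => (1 / 2 + e, 0) : R^o * R^o)}.
    have ce : {for 0, continuous (fun e : R => 1 / 2 + e)}.
      by apply: continuousD; [exact: cvg_cst | exact: cvg_id].
    have cz : {for 0, continuous (fun _ : R => 0 : R)} by exact: cvg_cst.
    exact: (cvg_pair ce cz).
  exact: (cvg_pair c1 (continuous_comp c2 (@disk_retraction_continuous _))).
rewrite /interior => hA.
have /ch/nbhs_ballP[e /= e0 eA] : nbhs (h 0) attractor by rewrite /h addr0.
(* The bound 1/4 keeps (1/2 + e', 0) in the disk, where the retraction is the identity. *)
pose e' := Num.min (e / 2) (1 / 4).
have [e'0 e'1 e'e] : [/\ 0 < e', e' <= 1 / 4 & e' < e].
  by rewrite /e' lt_min ge_min gt_min; split; lra.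
have /attractor_fst_le : attractor (h e').
  by apply: eA; rewrite /ball /= sub0r normrN gtr0_norm.
rewrite /h disk_retractionE /=; first lra.
rewrite /disk /= expr0n addr0; nra.
Qed.

(** One lift, defined on the whole cover, serves at every point, and its components are
    trigonometric polynomials. *)
Lemma skew_map_smooth : smooth_torus_map skew_map.
Proof.
have tw : trig_poly (fun p => weight (cos p.1) (sin p.1)).
  have tc := @trig_poly_cos R; have ts := @trig_poly_sin R.
  have tk := @trig_poly_cst R.
  have td := trig_polyD (trig_polyM tc tc) (trig_polyM (tk (-1)) (trig_polyM ts ts)).
  (* The class offers only sums and products, so the sixth power is built as the square of a
     cube. *)
  have td3 := trig_polyM td (trig_polyM td td).
  apply: (trig_poly_ext (trig_polyM (tk (9 / 10))
    (trig_polyD (tk 1) (trig_polyM (tk (-1)) (trig_polyM td3 td3))))) => p.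
  by rewrite /weight; ring.
have affine (e v : R^o * (R^o * R^o) -> R^o) : trig_poly e -> trig_poly v ->
    trig_poly (fun p => weight (cos p.1) (sin p.1) * v p +
                        (1 - weight (cos p.1) (sin p.1)) * (e p / 2)).
  move=> te tv; have tk := @trig_poly_cst R.
  apply: (trig_poly_ext (trig_polyD (trig_polyM tw tv)
    (trig_polyM (trig_polyD (tk 1) (trig_polyM (tk (-1)) tw))
                (trig_polyM te (tk 2^-1))))) => p.
  by rewrite mulN1r.
move=> p0 _; exists setT.
exists (fun p => (8 * p.1, fiber_map (cos p.1) (sin p.1) p.2)); split.
- by split=> //; exact: openT.
- apply: trig_poly_smooth.
  + exact: trig_polyM (trig_poly_cst 8) (@trig_poly_angle R).
  + exact: affine (@trig_poly_cos R) (@trig_poly_x R).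
  + exact: affine (@trig_poly_sin R) (@trig_poly_y R).
- move=> p [phi x] _ [/= <- px]; split; first by rewrite /= octupling_pi.
  by rewrite skew_map_pi_val px.
Qed.

End OctuplingSkewProduct.

Theorem theorem4 (R : realType) :
  exists F : solid_torus R -> solid_torus R,
    [/\ smooth_torus_map F,
        octupling_skew_product F &
        exists2 A : set (solid_torus R),
          Milnor_topological_attractor F A &
          ~ (F @` A° `<=` A°)].
Proof.
exists (@skew_map R); split; first exact: skew_map_smooth.
  by exists (fun phi x => (skew_map (phi, x)).2).
exists (global_attractor (@skew_map R)); last exact: skew_map_interior.
apply: global_attractor_Milnor.
- exact: solid_torus_compact.
- exact: solid_torus_hausdorff.
- exact: skew_map_continuous.
- by exists (\pi_(circle R)%qT 0%R, disk_retraction (0, 0)%R).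
- exact: iter_skew_map_visits.
Qed.
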